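(* Let $M$ be a pseudo MV-algebra and let $I$ be a lexicographic ideal of $M$. Then there are a linearly ordered unital group $(H,u)$ such that $M/I \cong \Gamma(H,u)$ and an $\ell$-group $G$ with $\langle I\rangle \cong \Gamma(\mathbb Z\overrightarrow{\times} G,(1,0))$ such that $M \cong \Gamma(H\overrightarrow{\times} G,(u,0))$. In addition, if there is an $\ell$-group $G'$ such that $M \cong \Gamma(H\overrightarrow{\times} G',(u,0))$, then $G'$ is isomorphic to $G$.
   Context: Groups are written additively and are not assumed Abelian. A pseudo MV-algebra is an algebra $(M;\oplus,{}^-,{}^\sim,0,1)$ of type $(2,1,1,0,0)$ such that, with $y\odot x:=(x^-\oplus y^-)^\sim$ (where $\odot$ binds more strongly than $\oplus$), for all $x,y,z\in M$: $x\oplus(y\oplus z)=(x\oplus y)\oplus z$; $x\oplus 0=0\oplus x=x$; $x\oplus 1=1\oplus x=1$; $1^\sim=1^-=0$; $(x^-\oplus y^-)^\sim=(x^\sim\oplus y^\sim)^-$; $x\oplus(x^\sim\odot y)=y\oplus(y^\sim\odot x)=(x\odot y^-)\oplus y=(y\odot x^-)\oplus x$; $x\odot(x^-\oplus y)=(x\oplus y^\sim)\odot y$; $(x^-)^\sim=x$. It is a distributive lattice, where the last two-sided identities define $x\vee y$ and $x\wedge y$ respectively. A unital $\ell$-group $(G,u)$ is an $\ell$-group (lattice-ordered group) $G$ with a fixed strong unit $u\in G^+=\{g\in G:g\ge 0\}$, i.e. $G=\bigcup_n[-nu,nu]$. A linearly ordered unital group is a unital $\ell$-group whose order is linear. For $u\in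 G^+$, $\Gamma(G,u):=[0,u]$ is the pseudo MV-algebra with $x\oplus y=(x+y)\wedge u$, $x^-=u-x$, $x^\sim=-x+u$, zero $0$ and unit $u$; then $x\odot y=(x-u+y)\vee 0$. Every pseudo MV-algebra is isomorphic to $\Gamma(G,u)$ for a unital $\ell$-group $(G,u)$ unique up to isomorphism, so one may write $M=\Gamma(K,v)$ and regard $M$ as a subset of $K$. The partial sum $x+y$ in $M$ is defined iff $x\odot y=0$, and then $x+y:=x\oplus y$ (the group sum in $K$). The lexicographic product $H\overrightarrow{\times}G$ is the group $H\times G$ with $(h,g)\le(h_1,g_1)$ iff $h<h_1$, or $h=h_1$ and $g\le g_1$. An ideal of $M$ is a non-empty down-set $I\subseteq M$ closed under $\oplus$. It is prime if $x\wedge y\in I$ implies $x\in I$ or $y\in I$; normal if $\{x\}\oplus I=I\oplus\{x\}$ for all $x\in M$. For a normal ideal $I$, $M/I$ is the quotient pseudo MV-algebra, whose classes are $x/I=\{y: (x\odot y^-)\oplus(y\odot x^-)\in I\}$, and $\pi_I:M\to M/I$ is the canonical projection. $I$ is strict if $x/I<y/I$ implies $x<y$. $I$ is retractive if there is a homomorphism $\delta_I:M/I\to M$ with $\pi_I\circ\delta_I=\mathrm{id}_{M/I}$. $\langle I\rangle$ denotes the least subalgebra of $M$ containing $I$. A normal ideal $I$ of $M=\Gamma(K,v)$ with $\{0\}\ne I\ne M$ is lexicographic if: (i) $I$ is strict; (ii) $I$ is retractive, with some homomorphism $\delta_I:M/I\to M$ satisfying $\pi_I\circ\delta_I=\mathrm{id}_{M/I}$,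 for which (iv) and (v) hold; (iii) $I$ is prime; (iv) writing $M/I=\Gamma(H,u)$ for the (linearly ordered) unital group $(H,u)$ representing $M/I$, for all $s,t\in[0,u]$ in $H$ with $s+t\le u$ and all $x\in\pi_I^{-1}(\{s\})$, $y\in\pi_I^{-1}(\{t\})$ we have $x+y-\delta_I(s+t)=(x-\delta_I(s))+(y-\delta_I(t))$, computed in $K$; (v) for all $t\in[0,u]$ in $H$ and all $x\in\pi_I^{-1}(\{t\})$, $x-\delta_I(t)=-\delta_I(t)+x$, computed in $K$.
   Formalization: In the ''In addition'' clause, the isomorphism of M with Γ(H ×lex G', (u,0)) is required to carry I onto {0} × G'^+; for arbitrary isomorphisms the clause fails (H = Z ×lex Z[X], u = (1,0), G = Z, G' = Z ×lex Z). *)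

(* Defs.v *)
From HB Require Import structures.
From mathcomp Require Import all_boot all_order all_algebra.
From mathcomp Require Import boolp classical_sets.
Set Implicit Arguments.
Unset Strict Implicit.
Unset Printing Implicit Defensive.
Import Order.TTheory.

Local Open Scope classical_set_scope.
Local Open Scope order_scope.

(* Additive writing for the (not necessarily commutative) groupType, whose own
   notations are multiplicative. *)
Declare Scope lgroup_scope.
Delimit Scope lgroup_scope with lg.
Notation "0" := (@monoid.one _) : lgroup_scope.
Notation "x + y" := (monoid.mul x y) : lgroup_scope.
Notation "- x" := (monoid.inv x) : lgroup_scope.
Notation "x - y" := (monoid.mul x (monoid.inv y)) : lgroup_scope.
Notation "x *+ n" := (natexp x n) : lgroup_scope.
Local Open Scope lgroup_scope.

Fact lgroup_display : Order.disp_t. Proof. exact: Order.Disp tt tt. Qed.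

HB.mixin Record isLGroup G of monoid.Group G & Order.Lattice lgroup_display G := {
  lg_leD2 : forall a b x y : G, (x <= y)%O -> (a + x + b <= a + y + b)%O
}.

#[short(type="lgroupType")]
HB.structure Definition LGroup :=
  {G of isLGroup G & monoid.Group G & Order.Lattice lgroup_display G}.

#[short(type="logroupType")]
HB.structure Definition LOGroup :=
  {G of LGroup G & Order.Total lgroup_display G}.

Definition strong_unit (G : lgroupType) (u : G) : Prop :=
  0 <= u /\ forall g : G, exists n : nat, - (u *+ n) <= g <= u *+ n.

Definition lgroup_isomorphism (G G' : lgroupType) (f : G -> G') : Prop :=
  [/\ {morph f : x y / x + y}, {morph f : x y / x `&` y},
      {morph f : x y / x `|` y} & bijective f].

Definition lgroup_isomorphic (G G' : lgroupType) : Prop :=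
  exists f : G -> G', lgroup_isomorphism f.

Section LGroupTheory.
Variable G : lgroupType.
Implicit Types x y z : G.

Lemma lg_leD2l z x y : x <= y -> z + x <= z + y.
Proof. by move=> /(lg_leD2 z 0); rewrite !mulg1. Qed.

Lemma lg_leD2r z x y : x <= y -> x + z <= y + z.
Proof. by move=> /(lg_leD2 0 z); rewrite !mul1g. Qed.

Lemma lg_addr_ge0 x y : 0 <= x -> 0 <= y -> 0 <= x + y.
Proof.
by move=> x0 y0; rewrite (le_trans x0)// -[leLHS]mulg1 lg_leD2l.
Qed.

Lemma lg_ltD2l z x y : x < y -> z + x < z + y.
Proof. by rewrite !lt_neqAle => /andP[ne /lg_leD2l ->]; rewrite (inj_eq (mulgI z)) ne. Qed.

Lemma lg_ltD2r z x y : x < y -> x + z < y + z.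
Proof. by rewrite !lt_neqAle => /andP[ne /lg_leD2r ->]; rewrite (inj_eq (mulIg z)) ne. Qed.

End LGroupTheory.

Definition Zgroup : Type := GRing.to_multiplicative int.

HB.instance Definition _ := monoid.Group.on Zgroup.

Section ZgroupOrder.
Import Num.Theory.
Let le (x y : Zgroup) : bool := ((x : int) <= (y : int))%R.
Let lt (x y : Zgroup) : bool := ((x : int) < (y : int))%R.
Let lt_def x y : lt x y = (y != x) && le x y. Proof. exact: lt_def. Qed.
Let meet_def x y : (if lt x y then x else y) = if lt x y then x else y.
Proof. by []. Qed.
Let join_def x y : (if lt x y then y else x) = if lt x y then y else x.
Proof. by []. Qed.
Let anti : antisymmetric le. Proof. exact: le_anti. Qed.
Let trans : transitive le. Proof. exact: le_trans. Qed.
Let total : total le. Proof. exact: le_total. Qed.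
HB.instance Definition _ := Order.isOrder.Build lgroup_display Zgroup
  lt_def meet_def join_def anti trans total.
End ZgroupOrder.

Fact Zgroup_leE (x y : Zgroup) : (x <= y) = ((x : int) <= (y : int))%R.
Proof. by []. Qed.

Fact Zgroup_leD2 (a b x y : Zgroup) : x <= y -> a + x + b <= a + y + b.
Proof.
by rewrite !Zgroup_leE => xy; rewrite Num.Theory.lerD2r Num.Theory.lerD2l.
Qed.
HB.instance Definition _ := isLGroup.Build Zgroup Zgroup_leD2.

Definition Zone : Zgroup := 1%R : int.

Lemma Zone_ge0 : 0 <= Zone. Proof. by []. Qed.

(* Lexicographic product of a linearly ordered group with an l-group: the group
   is the direct product and the order is the library's lexicographic order. *)

Definition lexprod (H : logroupType) (G : lgroupType) : Type := (H * G)%type.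

Section LexProd.
Variables (H : logroupType) (G : lgroupType).

HB.instance Definition _ := monoid.Group.copy (lexprod H G) (H * G)%type.
HB.instance Definition _ :=
  Order.POrder.copy (lexprod H G) (H *lexi[lgroup_display] G)%type.

Implicit Types x y z : lexprod H G.

Fact lexprod_leE x y : (x <= y) = (x.1 < y.1) || (x.1 == y.1) && (x.2 <= y.2).
Proof.
have -> : (x <= y) = (x.1 <= y.1) && ((x.1 >= y.1) ==> (x.2 <= y.2)) by [].
by case: ltgtP.
Qed.

Let meet x y : lexprod H G :=
  if x.1 < y.1 then x else if y.1 < x.1 then y else (x.1, x.2 `&` y.2).
Let join x y : lexprod H G :=
  if x.1 < y.1 then y else if y.1 < x.1 then x else (x.1, x.2 `|` y.2).

Let lexI z x y : (z <= meet x y) = (z <= x) && (z <= y).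
Proof.
rewrite /meet; case: (ltgtP x.1 y.1) => /= xy; rewrite !lexprod_leE /=.
- by case: (ltgtP z.1 x.1) => zx; rewrite /= ?andbF ?andbT // ?(lt_trans zx xy) // zx xy andbT.
- by case: (ltgtP z.1 y.1) => zy; rewrite /= ?andbF ?andbT // ?(lt_trans zy xy) // zy xy.
- by rewrite -xy; case: ltgtP => //= _; rewrite lexI.
Qed.

Let leUx x y z : (join x y <= z) = (x <= z) && (y <= z).
Proof.
rewrite /join; case: (ltgtP x.1 y.1) => /= xy; rewrite !lexprod_leE /=.
- by case: (ltgtP y.1 z.1) => yz; rewrite /= ?andbF ?andbT // ?(lt_trans xy yz) // -yz xy.
- by case: (ltgtP x.1 z.1) => xz; rewrite /= ?andbF ?andbT // ?(lt_trans xy xz) // -xz xy andbT.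
- by rewrite -xy; case: ltgtP => //= _; rewrite leUx.
Qed.

HB.instance Definition _ :=
  Order.POrder_MeetJoin_isLattice.Build lgroup_display (lexprod H G) lexI leUx.

Fact lexprod_leD2 (a b x y : lexprod H G) : x <= y -> a + x + b <= a + y + b.
Proof.
rewrite !lexprod_leE /= => /orP[xy|/andP[/eqP xy le2]].
  by rewrite lg_ltD2r ?lg_ltD2l.
by rewrite xy eqxx lg_leD2 ?orbT.
Qed.
HB.instance Definition _ := isLGroup.Build (lexprod H G) lexprod_leD2.

Definition lexunit (u : H) : lexprod H G := (u, 0).

Lemma lexunit_ge0 (u : H) : 0 <= u -> 0 <= lexunit u.
Proof. by rewrite lexprod_leE /= lexx andbT orbC -le_eqVlt. Qed.

End LexProd.
Arguments lexunit {H} G u.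
Arguments lexunit_ge0 {H} G {u}.

(* Algebras of type (2,1,1,0,0), without axioms: homomorphisms, quotients and
   Gamma only depend on the operations. *)

HB.mixin Record hasMVOps M := {
  mvadd : M -> M -> M;
  mvlneg : M -> M;
  mvrneg : M -> M;
  mv0 : M;
  mv1 : M
}.

#[short(type="mvSigType")]
HB.structure Definition MVSig := {M of hasMVOps M}.

Declare Scope mv_scope.
Delimit Scope mv_scope with mv.
Notation "x ⊕ y" := (mvadd x y) (at level 50, left associativity) : mv_scope.
Notation "x ⁻" := (mvlneg x) (at level 2, left associativity, format "x ⁻")
  : mv_scope.
Notation "x ∼" := (mvrneg x) (at level 2, left associativity, format "x ∼")
  : mv_scope.
Local Open Scope mv_scope.

Definition mvmul (M : mvSigType) (y x : M) : M := (x⁻ ⊕ y⁻)∼.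
Notation "x ⊙ y" := (mvmul x y) (at level 40, left associativity) : mv_scope.

Definition mvjoin (M : mvSigType) (x y : M) : M := x ⊕ (x∼ ⊙ y).
Definition mvmeet (M : mvSigType) (x y : M) : M := x ⊙ (x⁻ ⊕ y).
Definition mvle (M : mvSigType) (x y : M) : Prop := mvmeet x y = x.
Definition mvlt (M : mvSigType) (x y : M) : Prop := mvle x y /\ x <> y.

HB.mixin Record isPseudoMV M of MVSig M := {
  mvaddA : forall x y z : M, x ⊕ (y ⊕ z) = (x ⊕ y) ⊕ z;
  mvaddx0 : forall x : M, x ⊕ mv0 = x;
  mvadd0x : forall x : M, mv0 ⊕ x = x;
  mvaddx1 : forall x : M, x ⊕ mv1 = mv1;
  mvadd1x : forall x : M, mv1 ⊕ x = mv1;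
  mvrneg1 : (mv1 : M)∼ = mv0;
  mvlneg1 : (mv1 : M)⁻ = mv0;
  mvnegD : forall x y : M, (x⁻ ⊕ y⁻)∼ = (x∼ ⊕ y∼)⁻;
  mvjoinE1 : forall x y : M, x ⊕ (x∼ ⊙ y) = y ⊕ (y∼ ⊙ x);
  mvjoinE2 : forall x y : M, x ⊕ (x∼ ⊙ y) = (x ⊙ y⁻) ⊕ y;
  mvjoinE3 : forall x y : M, x ⊕ (x∼ ⊙ y) = (y ⊙ x⁻) ⊕ x;
  mvmeetE : forall x y : M, x ⊙ (x⁻ ⊕ y) = (x ⊕ y∼) ⊙ y;
  mvnegK : forall x : M, (x⁻)∼ = x
}.

#[short(type="pseudoMVType")]
HB.structure Definition PseudoMV := {M of isPseudoMV M & MVSig M}.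

Definition mv_homomorphism (A B : mvSigType) (f : A -> B) : Prop :=
  [/\ {morph f : x y / x ⊕ y}, {morph f : x / x⁻}, {morph f : x / x∼},
      f mv0 = mv0 & f mv1 = mv1].

Definition mv_isomorphism (A B : mvSigType) (f : A -> B) : Prop :=
  mv_homomorphism f /\ bijective f.

Definition mv_isomorphic (A B : mvSigType) : Prop :=
  exists f : A -> B, mv_isomorphism f.

Definition Gamma (G : lgroupType) (u : G) (u0 : 0 <= u) : Type :=
  {x : G | 0 <= x <= u}.

Section Gamma.
Variables (G : lgroupType) (u : G) (u0 : 0 <= u).

HB.instance Definition _ := SubType.on (Gamma u0).
HB.instance Definition _ := Choice.on (Gamma u0).

Fact Gamma_add_subproof (x y : Gamma u0) :
  0 <= (val x + val y) `&` u <= u.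
Proof.
case/andP: (valP x) => x0 _; case/andP: (valP y) => y0 _.
by rewrite lexI lg_addr_ge0 // u0 leIr.
Qed.

Fact Gamma_lneg_subproof (x : Gamma u0) : 0 <= u - val x <= u.
Proof.
case/andP: (valP x) => x0 xu; apply/andP; split.
  by have := lg_leD2r (- val x) xu; rewrite mulgV.
by have := lg_leD2 u (- val x) _ _ x0; rewrite mulgK mulg1.
Qed.

Fact Gamma_rneg_subproof (x : Gamma u0) : 0 <= - val x + u <= u.
Proof.
case/andP: (valP x) => x0 xu; apply/andP; split.
  by have := lg_leD2l (- val x) xu; rewrite mulVg.
by have := lg_leD2 (- val x) u _ _ x0; rewrite mulg1 mulVg mul1g.
Qed.

Fact Gamma_0_subproof : (0 : G) <= 0 <= u. Proof. by rewrite lexx. Qed.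
Fact Gamma_u_subproof : 0 <= u <= u. Proof. by rewrite lexx andbT. Qed.

Let mk (z : G) (hz : 0 <= z <= u) : Gamma u0 := exist _ z hz.

HB.instance Definition _ := hasMVOps.Build (Gamma u0)
  (fun x y => mk (Gamma_add_subproof x y))
  (fun x => mk (Gamma_lneg_subproof x))
  (fun x => mk (Gamma_rneg_subproof x))
  (mk Gamma_0_subproof) (mk Gamma_u_subproof).

End Gamma.

(* The ideal {0} x G^+ of Gamma(H x G, (u, 0)). *)
Definition lexinfinitesimal (H : logroupType) (G : lgroupType) (u : H)
    (u0 : 0 <= u) : set (Gamma (lexunit_ge0 G u0)) :=
  [set z | (val z).1 = 0].
Arguments lexinfinitesimal {H} G {u} u0.

Section Ideals.
Variable M : mvSigType.
Implicit Type I : set M.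

Definition mv_ideal I : Prop :=
  [/\ I !=set0, forall x y, mvle x y -> I y -> I x
    & forall x y, I x -> I y -> I (x ⊕ y)].

Definition mv_prime I : Prop := forall x y, I (mvmeet x y) -> I x \/ I y.

Definition mv_normal I : Prop :=
  forall x : M, [set x ⊕ i | i in I] = [set i ⊕ x | i in I].

Definition mvclass I (x : M) : set M := [set y | I ((x ⊙ y⁻) ⊕ (y ⊙ x⁻))].

Definition mvquot I : Type := {C : set M | exists x, C = mvclass I x}.

Definition mvpi I (x : M) : mvquot I := exist _ (mvclass I x) (ex_intro _ x erefl).

Definition mvrepr I (q : mvquot I) : M := projT1 (cid (proj2_sig q)).

Lemma mvreprK I : cancel (@mvrepr I) (@mvpi I).
Proof.
by move=> [C HC]; apply: eq_exist; rewrite /mvrepr; case: cid => x /= ->.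
Qed.

(* The operations act on chosen representatives of the classes; for a normal
   ideal of a pseudo MV-algebra the result does not depend on the choice. *)
HB.instance Definition _ I := hasMVOps.Build (mvquot I)
  (fun p q => mvpi I (mvrepr p ⊕ mvrepr q))
  (fun p => mvpi I (mvrepr p)⁻)
  (fun p => mvpi I (mvrepr p)∼)
  (mvpi I mv0) (mvpi I mv1).

Definition mv_strict I : Prop :=
  forall x y : M, mvlt (mvpi I x) (mvpi I y) -> mvlt x y.

Definition mv_retraction I (delta : mvquot I -> M) : Prop :=
  mv_homomorphism delta /\ cancel delta (@mvpi I).

Definition mv_subalgebra (S : set M) : Prop :=
  [/\ forall x y, S x -> S y -> S (x ⊕ y), forall x, S x -> S x⁻,
      forall x, S x -> S x∼, S mv0 & S mv1].

Definition mvgen I : Type := {x : M | smallest mv_subalgebra I x}.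

Fact mvgen_subalgebra I : mv_subalgebra (smallest mv_subalgebra I).
Proof.
split=> [x y Sx Sy|x Sx|x Sx||] A hA; have [[AD Al Ar A0 A1] _] := hA => //.
- by apply: AD; [exact: Sx hA|exact: Sy hA].
- exact: Al (Sx _ hA).
- exact: Ar (Sx _ hA).
Qed.

Section GeneratedSubalgebra.
Variable I : set M.
Let S := smallest mv_subalgebra I.
Let SD : forall x y, S x -> S y -> S (x ⊕ y).
Proof. by case: (mvgen_subalgebra I). Qed.
Let Sl : forall x, S x -> S x⁻. Proof. by case: (mvgen_subalgebra I). Qed.
Let Sr : forall x, S x -> S x∼. Proof. by case: (mvgen_subalgebra I). Qed.
Let S0 : S mv0. Proof. by case: (mvgen_subalgebra I). Qed.
Let S1 : S mv1. Proof. by case: (mvgen_subalgebra I). Qed.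

HB.instance Definition _ := hasMVOps.Build (mvgen I)
  (fun x y => exist S _ (SD (svalP x) (svalP y)))
  (fun x => exist S _ (Sl (svalP x)))
  (fun x => exist S _ (Sr (svalP x)))
  (exist S _ S0) (exist S _ S1).
End GeneratedSubalgebra.

End Ideals.

Section Lexicographic.
Variables (M : pseudoMVType) (I : set M).
(* M is identified with Gamma(K, v) along phi. *)
Variables (K : lgroupType) (v : K) (v0 : 0 <= v) (phi : M -> Gamma v0).
Variable delta : mvquot I -> M.

Let inK (x : M) : K := val (phi x).

(* M/I is identified with Gamma(H, u) along rho.  The hypothesis on r says that
   s + t <= u and that r is the sum s + t of H, regarded as an element of
   [0, u]. *)
Definition lex_additive (H : logroupType) (u : H) (u0 : 0 <= u)
    (rho : Gamma u0 -> mvquot I) : Prop :=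
  forall s t r : Gamma u0, val r = val s + val t ->
  forall x y : M, mvpi I x = rho s -> mvpi I y = rho t ->
  inK x + inK y - inK (delta (rho r)) =
  (inK x - inK (delta (rho s))) + (inK y - inK (delta (rho t))).

Definition lex_commuting (H : logroupType) (u : H) (u0 : 0 <= u)
    (rho : Gamma u0 -> mvquot I) : Prop :=
  forall (t : Gamma u0) (x : M), mvpi I x = rho t ->
  inK x - inK (delta (rho t)) = - inK (delta (rho t)) + inK x.

End Lexicographic.

Definition lexicographic_ideal (M : pseudoMVType) (I : set M) : Prop :=
  [/\ mv_ideal I /\ mv_normal I,
      I <> [set mv0] /\ I <> setT,
      mv_strict I,
      mv_prime I
    & exists (K : lgroupType) (v : K) (v0 : 0 <= v) (phi : M -> Gamma v0)
             (delta : mvquot I -> M),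
      [/\ strong_unit v, mv_isomorphism phi, mv_retraction delta
        & forall (H : logroupType) (u : H) (u0 : 0 <= u)
                 (rho : Gamma u0 -> mvquot I),
          strong_unit u -> mv_isomorphism rho ->
          lex_additive phi delta rho /\ lex_commuting phi delta rho]].

(* Main.v *)
Require Import Defs.
From HB Require Import structures.
From mathcomp Require Import all_boot all_order all_algebra.
From mathcomp Require Import boolp classical_sets.
Set Implicit Arguments.
Unset Strict Implicit.
Unset Printing Implicit Defensive.
Import Order.TTheory.

Local Open Scope classical_set_scope.
Local Open Scope order_scope.
Local Open Scope lgroup_scope.
Local Open Scope mv_scope.

(** Let [M = Gamma(K, v)] and let [delta] be the given retraction of [M -> M/I].
    Everything takes place inside [K].

    The image [D] of [delta] is a subalgebra of [Gamma(K, v)] isomorphic to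
    [M/I], and it is a chain because [I] is prime and meets [D] only in [0].
    The elements [d + z v] with [d] in [D] and [z] an integer form a subgroup [H]
    of [K], since conjugation by [v] preserves [D] and a sum of two elements of
    [D] exceeds [v], if at all, by an element of [D].  It is linearly ordered,
    because [D] is and lies between [0] and [v], and [Gamma(H, v)] is [D]
    ([chain_span_total], [chain_span_Gamma], [retract_Gamma_iso]).

    The elements of [K] lying between [- a] and [b] for some [a] and [b] in [I]
    form an l-subgroup [G]: sums of elements of [I] are never truncated at [v]
    ([ideal_rep_add]).  The additivity of [delta], applied to an element of [D]
    and one of [I], says that they commute; hence [H] and [G] commute and
    [(h, g) |-> h + g] is a homomorphism from the product to [K].  Strictness
    puts [G] below every positive element of [H], so the map embeds the
    lexicographic product ([lexemb_le]), and every [x] in [M] is the sum of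
    [delta (x / I)] and an element of [G].  This is the isomorphism of [M] with
    [Gamma(H x G, (v, 0))] ([retract_embedding]).  With the multiples of [v] in
    place of [H], the same embedding has [<I>] as its image
    ([mvgen_isomorphic]).

    For uniqueness, the isomorphism of [M] with [Gamma(H x G', (v, 0))] matches
    the infinitesimals [(0, g)], [g >= 0], of the two lexicographic algebras.
    These form the positive cones of [G] and [G'], and an l-group is determined
    by its positive cone ([lgroup_isomorphic_cone]). *)

(** * Lattice-ordered groups *)

Section LGroupFacts.
Variable G : lgroupType.
Implicit Types a b c x y z : G.

Lemma lg_leD2lE z x y : (z + x <= z + y) = (x <= y).
Proof.
by apply/idP/idP => [/(lg_leD2l (- z))|/lg_leD2l//]; rewrite !mulKg.
Qed.

Lemma lg_leD2rE z x y : (x + z <= y + z) = (x <= y).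
Proof.
by apply/idP/idP => [/(lg_leD2r (- z))|/lg_leD2r//]; rewrite !mulgK.
Qed.

Lemma lg_ltD2rE z x y : (x + z < y + z) = (x < y).
Proof. by rewrite !lt_neqAle lg_leD2rE (inj_eq (mulIg z)). Qed.

Lemma lg_leD x y z t : x <= y -> z <= t -> x + z <= y + t.
Proof. by move=> xy zt; apply: (le_trans (lg_leD2r z xy)); apply: lg_leD2l. Qed.

Lemma lg_subr_ge0 x y : (0 <= y - x) = (x <= y).
Proof. by rewrite -[LHS](lg_leD2rE x) mul1g mulgVK. Qed.

Lemma lg_subr_gt0 x y : (0 < y - x) = (x < y).
Proof. by rewrite -[LHS](lg_ltD2rE x) mul1g mulgVK. Qed.

Lemma lg_leN2 x y : (- x <= - y) = (y <= x).
Proof. by rewrite -[LHS](lg_leD2lE x) mulgV lg_subr_ge0. Qed.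

Lemma lg_leNl x y : (- x <= y) = (- y <= x).
Proof. by rewrite -[in LHS](invgK y) lg_leN2. Qed.

Lemma lg_oppr_le0 x : (- x <= 0) = (0 <= x).
Proof. by rewrite -[leRHS]invg1 lg_leN2. Qed.

Lemma lg_leNDl x y z : (- z + x <= y) = (x <= z + y).
Proof. by rewrite -[LHS](lg_leD2lE z) mulVKg. Qed.

Lemma lg_leBDr x y z : (x - z <= y) = (x <= y + z).
Proof. by rewrite -[LHS](lg_leD2rE z) mulgVK. Qed.

Lemma lg_leDNl x y z : (x <= - z + y) = (z + x <= y).
Proof. by rewrite -[LHS](lg_leD2lE z) mulVKg. Qed.

Lemma lg_leDBr x y z : (x <= y - z) = (x + z <= y).
Proof. by rewrite -[LHS](lg_leD2rE z) mulgVK. Qed.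

Lemma lg_meetDl z x y : z + (x `&` y) = (z + x) `&` (z + y).
Proof.
apply/le_anti; rewrite lexI !lg_leD2l ?leIl ?leIr //=.
by rewrite -lg_leNDl lexI !lg_leNDl leIl leIr.
Qed.

Lemma lg_meetDr z x y : (x `&` y) + z = (x + z) `&` (y + z).
Proof.
apply/le_anti; rewrite lexI !lg_leD2r ?leIl ?leIr //=.
by rewrite -lg_leBDr lexI !lg_leBDr leIl leIr.
Qed.

Lemma lg_joinDl z x y : z + (x `|` y) = (z + x) `|` (z + y).
Proof.
apply/le_anti; rewrite leUx !lg_leD2l ?leUl ?leUr //= andbT.
by rewrite -lg_leDNl leUx !lg_leDNl leUl leUr.
Qed.

Lemma lg_joinDr z x y : (x `|` y) + z = (x + z) `|` (y + z).
Proof.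
apply/le_anti; rewrite leUx !lg_leD2r ?leUl ?leUr //= andbT.
by rewrite -lg_leDBr leUx !lg_leDBr leUl leUr.
Qed.

Lemma lg_oppI x y : - (x `&` y) = - x `|` - y.
Proof.
apply/le_anti; rewrite leUx !lg_leN2 leIl leIr !andbT.
by rewrite lg_leNl lexI lg_leNl leUl lg_leNl leUr.
Qed.

(** The positive and negative parts of [x] exhibit every element of an l-group
    as a difference of positive ones. *)
Lemma lg_pos_neg x : x = (x `|` 0) - (- x `|` 0).
Proof.
apply: (@mulIg _ (- x `|` 0)); rewrite mulgVK lg_joinDl mulgV mulg1.
exact: joinC.
Qed.

Lemma lg_pos_neg_disjoint x : (x `|` 0) `&` (- x `|` 0) = 0.
Proof.
have nE : - x `|` 0 = - (x `&` 0) by rewrite lg_oppI invg1.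
have -> : x `|` 0 = x + (- x `|` 0) by rewrite lg_joinDl mulgV mulg1 joinC.
by rewrite -[X in _ `&` X]mul1g -lg_meetDr nE mulgV.
Qed.

Lemma lg_join_closed (S : {pred G}) :
  monoid.group_closed S -> meet_closed S -> join_closed S.
Proof.
move=> gS iS x y Sx Sy; rewrite -[x]invgK -[y]invgK -lg_oppI.
by apply: (group_closedV gS); apply: iS; apply: (group_closedV gS).
Qed.

End LGroupFacts.

(** * Extension of an isomorphism of positive cones *)

Lemma order_iso_morph (G G' : lgroupType) (f : G -> G') (g : G' -> G) :
  cancel f g -> cancel g f -> {homo f : x y / x <= y} ->
  {homo g : x y / x <= y} ->
  {morph f : x y / x `&` y} /\ {morph f : x y / x `|` y}.
Proof.
move=> fK gK fle gle; split=> x y; apply/le_anti.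
- rewrite lexI !fle ?leIl ?leIr //= -[leLHS]gK fle// lexI.
  by rewrite -{2}(fK x) -{3}(fK y) !gle ?leIl ?leIr.
- rewrite leUx !fle ?leUl ?leUr // andbT -[leRHS]gK fle// leUx.
  by rewrite -{1}(fK x) -{2}(fK y) !gle ?leUl ?leUr.
Qed.

Section ConeExtension.
Variables (G G' : lgroupType) (t : G -> G').
Hypothesis t_ge0 : forall a, 0 <= a -> 0 <= t a.
Hypothesis tD : forall a b, 0 <= a -> 0 <= b -> t (a + b) = t a + t b.

(** The only possible additive extension of [t], as [x] is the difference of its
    positive and negative parts. *)
Definition cone_ext (x : G) : G' := t (x `|` 0) - t (- x `|` 0).

Lemma cone_ext0 : t 0 = 0.
Proof. by apply: (@mulgI _ (t 0)); rewrite -tD// !mulg1. Qed.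

(** In the absence of commutativity [a - b = c - d] does not compare [a + d] with
    [c + b]; positive [p] and [q] with [b + p = d + q] play the role of a common
    denominator, and then [a + p = c + q]. *)
Lemma cone_ext_sub_wd a b c d : 0 <= a -> 0 <= b -> 0 <= c -> 0 <= d ->
  a - b = c - d -> t a - t b = t c - t d.
Proof.
move=> a0 b0 c0 d0 abcd.
pose p := (- b + d) `|` 0; pose q := - (- b + d) `|` 0.
have p0 : 0 <= p by exact: leUr.
have q0 : 0 <= q by exact: leUr.
have bd : - b + d = p - q by exact: lg_pos_neg.
have bpdq : b + p = d + q.
  by apply: (@mulIg _ (- q)); rewrite mulgK -mulgA -bd mulVKg.
have apcq : a + p = c + q.
  have -> : a = c - d + b by rewrite -abcd mulgVK.
  by rewrite -mulgA bpdq mulgA mulgVK.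
apply: (@mulIg _ (t b + t p)); rewrite !mulgA mulgVK.
by rewrite -!mulgA -!tD// apcq bpdq !tD// mulKg.
Qed.

Lemma cone_ext_sub a b : 0 <= a -> 0 <= b -> cone_ext (a - b) = t a - t b.
Proof.
by move=> a0 b0; apply: cone_ext_sub_wd; rewrite ?leUr// -lg_pos_neg.
Qed.

(** The inner terms of [(a - b) + (c - d)] are rewritten as [- b + c = p - q] with
    [p] and [q] positive, which makes the sum a difference of two positive
    elements. *)
Lemma cone_extD : {morph cone_ext : x y / x + y}.
Proof.
move=> x y; rewrite {2 3}/cone_ext.
set a := x `|` 0; set b := - x `|` 0; set c := y `|` 0; set d := - y `|` 0.
have [a0 b0 c0 d0] : [/\ 0 <= a, 0 <= b, 0 <= c & 0 <= d].
  by split; exact: leUr.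
pose p := (- b + c) `|` 0; pose q := - (- b + c) `|` 0.
have p0 : 0 <= p by exact: leUr.
have q0 : 0 <= q by exact: leUr.
have bc : - b + c = p - q by exact: lg_pos_neg.
have -> : x + y = (a + p) - (d + q).
  rewrite [x]lg_pos_neg [y]lg_pos_neg -/a -/b -/c -/d invgM !mulgA.
  by rewrite -(mulgA a) bc !mulgA.
rewrite cone_ext_sub ?lg_addr_ge0// !tD// invgM !mulgA.
congr (_ - _); rewrite -!mulgA; congr (_ + _).
have bpcq : b + p = c + q.
  by apply: (@mulIg _ (- q)); rewrite mulgK -mulgA -bc mulVKg.
apply: (@mulgI _ (t b)); apply: (@mulIg _ (t q)).
by rewrite mulVKg !mulgA mulgVK -!tD// bpcq.
Qed.

Lemma cone_ext_ge0 x : 0 <= x -> cone_ext x = t x.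
Proof.
move=> x0; have := cone_ext_sub x0 (lexx 0).
by rewrite cone_ext0 !invg1 !mulg1.
Qed.

Lemma cone_ext_homo : {homo cone_ext : x y / x <= y}.
Proof.
move=> x y; rewrite -lg_subr_ge0 => xy.
rewrite -[y](mulgVK x) cone_extD -[leLHS]mul1g lg_leD2r//.
by rewrite cone_ext_ge0 ?t_ge0.
Qed.

End ConeExtension.

(** An l-group is determined by the monoid of its positive elements: it is the
    group of differences of that monoid, and the monoid defines the order. *)
Lemma lgroup_isomorphic_cone (G G' : lgroupType) (t : G -> G') (s : G' -> G) :
  (forall a, 0 <= a -> 0 <= t a) -> (forall b, 0 <= b -> 0 <= s b) ->
  (forall a b, 0 <= a -> 0 <= b -> t (a + b) = t a + t b) ->
  (forall a, 0 <= a -> s (t a) = a) -> (forall b, 0 <= b -> t (s b) = b) ->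
  lgroup_isomorphic G G'.
Proof.
move=> t0 s0 tD tK sK.
have sD a b : 0 <= a -> 0 <= b -> s (a + b) = s a + s b.
  move=> a0 b0; rewrite -{1}(sK a)// -{1}(sK b)// -tD ?s0// tK//.
  by rewrite lg_addr_ge0 ?s0.
have extK (X Y : lgroupType) (f : X -> Y) (g : Y -> X) :
    (forall a, 0 <= a -> 0 <= f a) ->
    (forall a b, 0 <= a -> 0 <= b -> g (a + b) = g a + g b) ->
    (forall a, 0 <= a -> g (f a) = a) -> cancel (cone_ext f) (cone_ext g).
  move=> f0 gD fK x; rewrite {2}/cone_ext cone_ext_sub ?f0 ?leUr//.
  by rewrite !fK ?leUr// -lg_pos_neg.
have teK := extK _ _ t s t0 sD tK; have seK := extK _ _ s t s0 tD sK.
have [fI fU] := order_iso_morph teK seK (cone_ext_homo t0 tD)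
  (cone_ext_homo s0 sD).
by exists (cone_ext t); split=> //; [exact: cone_extD|exists (cone_ext s)].
Qed.

(** * Intervals of l-groups *)

Section GammaFacts.
Variables (G : lgroupType) (u : G) (u0 : 0 <= u).
Implicit Types x y : Gamma u0.

Lemma Gamma_ge0 x : 0 <= val x. Proof. by case/andP: (valP x). Qed.

Lemma Gamma_leu x : val x <= u. Proof. by case/andP: (valP x). Qed.

Lemma val_mvadd x y : val (x ⊕ y) = (val x + val y) `&` u. Proof. by []. Qed.

Lemma val_mvlneg x : val x⁻ = u - val x. Proof. by []. Qed.

Lemma val_mvrneg x : val x∼ = - val x + u. Proof. by []. Qed.

Lemma val_mv0 : val (mv0 : Gamma u0) = 0. Proof. by []. Qed.

Lemma val_mvmul x y : val (x ⊙ y) = (val x - u + val y) `|` 0.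
Proof.
rewrite val_mvrneg val_mvadd !val_mvlneg lg_oppI lg_joinDr mulVg.
by rewrite !invgM !invgK !mulgA mulgVK.
Qed.

Lemma val_mvdiff x y : val (x ⊙ y⁻) = (val x - val y) `|` 0.
Proof. by rewrite val_mvmul val_mvlneg mulgA mulgVK. Qed.

Lemma val_mvmeet x y : val (mvmeet x y) = val x `&` val y.
Proof.
rewrite val_mvmul val_mvadd val_mvlneg lg_meetDl mulgVK.
rewrite -!mulgA mulKg mulVKg meetC; apply/join_idPl.
by rewrite lexI !Gamma_ge0.
Qed.

Lemma mvleE x y : mvle x y <-> val x <= val y.
Proof.
split=> [<-|xy]; first by rewrite val_mvmeet leIr.
by apply: val_inj; rewrite val_mvmeet; apply/meet_idPl.
Qed.

Lemma Gamma_rnegK x : x∼⁻ = x.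
Proof. by apply: val_inj; rewrite val_mvlneg val_mvrneg invgM invgK mulVKg. Qed.

End GammaFacts.

Lemma lexGamma_fst (H : logroupType) (G : lgroupType) (u : H) (u0 : 0 <= u)
  (z : Gamma (lexunit_ge0 G u0)) : 0 <= (val z).1 <= u.
Proof.
have := valP z; rewrite !lexprod_leE !le_eqVlt /=.
by move=> /andP[/orP[->|/andP[-> _]] /orP[->|/andP[-> _]]]; rewrite ?orbT.
Qed.

(** * Homomorphisms *)

Lemma inj_surj_can (A B : Type) (f : A -> B) : injective f ->
  (forall y, exists x, f x = y) -> exists2 g, cancel f g & cancel g f.
Proof.
move=> f_inj f_surj; pose g y := projT1 (cid (f_surj y)).
have gK : cancel g f by move=> y; rewrite /g; case: cid.
by exists g => //; exact: inj_can_sym gK f_inj.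
Qed.

Section Homomorphisms.
Variables (A B C : mvSigType).

Lemma mv_hom_mul (f : A -> B) : mv_homomorphism f -> {morph f : x y / x ⊙ y}.
Proof. by case=> fD fl fr _ _ x y; rewrite /mvmul fr fD !fl. Qed.

Lemma mv_hom_meet (f : A -> B) :
  mv_homomorphism f -> {morph f : x y / mvmeet x y}.
Proof.
move=> fh x y; rewrite /mvmeet mv_hom_mul//.
by case: fh => fD fl _ _ _; rewrite fD fl.
Qed.

Lemma mv_hom_comp (f : A -> B) (g : B -> C) :
  mv_homomorphism f -> mv_homomorphism g -> mv_homomorphism (g \o f).
Proof.
case=> fD fl fr f0 f1 [gD gl gr g0 g1].
by split=> [x y|x|x||] /=; rewrite ?(fD, fl, fr, f0, f1).
Qed.

Lemma mv_hom_can (f : A -> B) (g : B -> A) :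
  mv_homomorphism f -> cancel f g -> cancel g f -> mv_homomorphism g.
Proof.
case=> fD fl fr f0 f1 fK gK; have fI := can_inj fK.
by split=> [x y|x|x||]; apply: fI; rewrite ?(fD, fl, fr, f0, f1) !gK.
Qed.

Lemma mv_isomorphic_can (f : A -> B) (g : B -> A) :
  mv_homomorphism f -> cancel f g -> cancel g f -> mv_isomorphic A B.
Proof. by move=> fh fK gK; exists f; split=> //; exists g. Qed.

End Homomorphisms.

(** * Infinitesimals of a lexicographic algebra *)

Section ConeOfLexGamma.
Variables (H : logroupType) (u : H) (u0 : 0 <= u) (u_gt0 : 0 < u).
Variable G : lgroupType.
Implicit Types a b : G.

Fact infinitesimal_subproof a :
  (0 : lexprod H G) <= ((0, a `|` 0) : lexprod H G) <= lexunit G u.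
Proof. by rewrite !lexprod_leE /= eqxx leUr ltxx u_gt0. Qed.

(** Taking the positive part of [a] makes the map total; only its values on
    positive [a] matter. *)
Definition infinitesimal a : Gamma (lexunit_ge0 G u0) :=
  exist _ ((0, a `|` 0) : lexprod H G) (infinitesimal_subproof a).

Lemma val_infinitesimal a : 0 <= a -> val (infinitesimal a) = (0, a).
Proof. by move=> a0; congr pair; apply/join_idPl. Qed.

Lemma infinitesimalP (z : Gamma (lexunit_ge0 G u0)) :
  (val z).1 = 0 -> 0 <= (val z).2 /\ infinitesimal (val z).2 = z.
Proof.
move=> z1; have z2 : 0 <= (val z).2.
  by have := Gamma_ge0 z; rewrite lexprod_leE z1 ltxx eqxx.
split=> //; apply: val_inj; rewrite val_infinitesimal// -z1.
by case: (val z).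
Qed.

(** The sum is not truncated, because [0 < u] puts every [(0, g)] below the unit. *)
Lemma infinitesimalD a b : 0 <= a -> 0 <= b ->
  infinitesimal (a + b) = infinitesimal a ⊕ infinitesimal b.
Proof.
move=> a0 b0; apply: val_inj.
rewrite val_mvadd !val_infinitesimal ?lg_addr_ge0//.
have -> : ((0, a) : lexprod H G) + (0, b) = (0, a + b).
  by congr pair; rewrite mulg1.
by apply/esym/meet_idPl; rewrite lexprod_leE /= u_gt0.
Qed.

End ConeOfLexGamma.

(** In [Gamma(H x G, (u, 0))] with [u > 0] the infinitesimals form a copy of
    the positive cone of [G], since no sum of two of them is truncated; hence
    they determine [G]. *)
Lemma lgroup_isomorphic_infinitesimal (H : logroupType) (u : H) (u0 : 0 <= u)
    (G G' : lgroupType)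
    (f : Gamma (lexunit_ge0 G u0) -> Gamma (lexunit_ge0 G' u0)) :
  0 < u -> mv_isomorphism f ->
  (forall z, (val (f z)).1 = 0 <-> (val z).1 = 0) ->
  lgroup_isomorphic G G'.
Proof.
move=> u_gt0 [[fD _ _ _ _] [g fK gK]] finf.
pose i (X : lgroupType) := @infinitesimal H u u0 u_gt0 X.
have i0 (X : lgroupType) (a : X) : (val (i X a)).1 = 0 by [].
have f1 a : (val (f (i G a))).1 = 0 by apply/finf.
have g1 b : (val (g (i G' b))).1 = 0 by apply/finf; rewrite gK.
apply: (@lgroup_isomorphic_cone _ _ (fun a => (val (f (i G a))).2)
                               (fun b => (val (g (i G' b))).2)).
- by move=> a _; have [] := infinitesimalP u_gt0 (f1 a).
- by move=> b _; have [] := infinitesimalP u_gt0 (g1 b).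
- move=> a b a0 b0; rewrite /i infinitesimalD// fD.
  have [fa0 <-] := infinitesimalP u_gt0 (f1 a).
  have [fb0 <-] := infinitesimalP u_gt0 (f1 b).
  by rewrite -infinitesimalD// !val_infinitesimal ?lg_addr_ge0.
- move=> a a0; have [_] := infinitesimalP u_gt0 (f1 a); rewrite -/(i _ _) => ->.
  by rewrite fK val_infinitesimal.
- move=> b b0; have [_] := infinitesimalP u_gt0 (g1 b); rewrite -/(i _ _) => ->.
  by rewrite gK val_infinitesimal.
Qed.

(** * Sub-l-groups *)

(** The closure proofs are parameters of the carrier, so that the l-group
    structure can be found from the type alone. *)
Definition lsub (K : lgroupType) (S : {pred K}) (gS : monoid.group_closed S)
  (iS : meet_closed S) : Type := {x : K | x \in S}.

Section LSubgroup.
Variables (K : lgroupType) (S : {pred K}).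
Variables (gS : monoid.group_closed S) (iS : meet_closed S).
HB.instance Definition _ := SubType.copy (lsub gS iS) {x : K | x \in S}.
HB.instance Definition _ := Choice.copy (lsub gS iS) {x : K | x \in S}.
HB.instance Definition _ :=
  monoid.SubChoice_isSubGroup.Build K (fun x => x \in S) (lsub gS iS) gS.
HB.instance Definition _ :=
  Order.SubChoice_isSubLattice.Build _ K (fun x => x \in S) lgroup_display
    (lsub gS iS) iS (lg_join_closed gS iS).

Fact lsub_leD2 (a b x y : lsub gS iS) : x <= y -> a + x + b <= a + y + b.
Proof. exact: lg_leD2. Qed.
HB.instance Definition _ := isLGroup.Build (lsub gS iS) lsub_leD2.
End LSubgroup.

(** * Integer multiples of an element *)

Section IntegerMultiples.
Variables (K : lgroupType) (v : K).

Definition zmul (z : Zgroup) : K :=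
  match (z : int) with Posz n => v *+ n | Negz n => - (v *+ n.+1) end.

Lemma zmulS (z : int) : zmul (z + 1)%R = zmul z + v.
Proof.
case: z => [n|[|n]]; rewrite /zmul /=.
- by rewrite addn1 expgSr.
- by rewrite mulVg.
- by rewrite subn1 /= [in RHS]expgS invgM mulgVK.
Qed.

Lemma zmulD : {morph zmul : x y / x + y}.
Proof.
move=> x y; change (zmul ((x : int) + (y : int))%R = zmul x + zmul y).
elim/int_ind: (y : int) => [|n IH|n IH].
- by rewrite GRing.addr0 mulg1.
- by rewrite -addn1 PoszD GRing.addrA !zmulS IH mulgA.
- apply: (@mulIg _ v); rewrite -zmulS -mulgA -zmulS -addn1 PoszD.
  by rewrite GRing.opprD !GRing.addrA !GRing.subrK.
Qed.

Lemma zmul_commute z x : commute v x -> commute (zmul z) x.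
Proof.
move=> vx; have nx n : commute (v *+ n) x.
  by apply/commute_sym/commuteX/commute_sym.
by case: z => n; [exact: nx|apply/commute_sym/commuteV/commute_sym/nx].
Qed.

Lemma zmul1 : zmul Zone = v. Proof. exact: expg1. Qed.

Lemma zmul0 : zmul 0 = 0. Proof. by []. Qed.

Lemma zmulN z : zmul (- z) = - zmul z.
Proof. by apply: (@mulIg _ (zmul z)); rewrite -zmulD !mulVg. Qed.

Lemma zmul_ge0 z : 0 <= v -> 0 <= z -> 0 <= zmul z.
Proof.
case: z => // n v0 _; rewrite /zmul /=.
by elim: n => //= n IH; rewrite expgS lg_addr_ge0.
Qed.

Lemma zmul_homo : 0 <= v -> {homo zmul : x y / x <= y}.
Proof.
move=> v0 x y xy; rewrite -lg_subr_ge0 -zmulN -zmulD zmul_ge0//.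
by rewrite lg_subr_ge0.
Qed.

Lemma Zone_le (z : Zgroup) : 0 < z -> Zone <= z.
Proof. by []. Qed.

Lemma zmul_gt0_le z : 0 <= v -> 0 < z -> v <= zmul z.
Proof. by move=> v0 /Zone_le/(zmul_homo v0); rewrite zmul1. Qed.

End IntegerMultiples.

(** * Lexicographic products inside an l-group *)

Section LexEmbedding.
Variables (H : logroupType) (G K : lgroupType) (i : H -> K) (j : G -> K).
Hypothesis iD : {morph i : x y / x + y}.
Hypothesis jD : {morph j : x y / x + y}.
Hypothesis jI : {morph j : x y / x `&` y}.
Hypothesis j_inj : injective j.
Hypothesis ijC : forall h g, i h + j g = j g + i h.
Hypothesis ij_gt0 : forall h g, 0 < h -> 0 < i h + j g.

Definition lexemb (p : lexprod H G) : K := i p.1 + j p.2.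

Let i0 : i 0 = 0. Proof. by apply: (@mulgI _ (i 0)); rewrite -iD !mulg1. Qed.
Let j0 : j 0 = 0. Proof. by apply: (@mulgI _ (j 0)); rewrite -jD !mulg1. Qed.

Lemma lexembD : {morph lexemb : x y / x + y}.
Proof.
move=> x y; rewrite /lexemb iD jD !mulgA; congr (_ + _).
by rewrite -!mulgA ijC.
Qed.

Lemma lexemb0 : lexemb 0 = 0. Proof. by rewrite /lexemb i0 j0 mulg1. Qed.

Lemma lexembN x : lexemb (- x) = - lexemb x.
Proof. by apply: (@mulIg _ (lexemb x)); rewrite -lexembD !mulVg lexemb0. Qed.

(** When the first components are equal, [j] reflects the order since it is
    injective and preserves meets; otherwise the first component decides on both
    sides. *)
Lemma lexemb_ge0 x : (0 <= lexemb x) = (0 <= x).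
Proof.
have pos y : 0 < y.1 -> 0 < lexemb y by exact: ij_gt0.
rewrite [RHS]lexprod_leE /=; case: (ltgtP 0 x.1) => [/pos/ltW->//|x1|x1] /=.
  apply/negbTE/negP; rewrite -lg_oppr_le0 -lexembN => le0.
  have /pos : 0 < (- x).1 by rewrite -(lg_ltD2rE x.1) mulVg mul1g.
  by move=> /lt_le_trans/(_ le0); rewrite ltxx.
rewrite /lexemb -x1 i0 mul1g -j0; apply/meet_idPl/meet_idPl.
  by rewrite -jI => /j_inj.
by move=> xx; rewrite -jI xx.
Qed.

Lemma lexemb_le x y : (lexemb x <= lexemb y) = (x <= y).
Proof. by rewrite -lg_subr_ge0 -lexembN -lexembD lexemb_ge0 lg_subr_ge0. Qed.

Lemma lexemb_inj : injective lexemb.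
Proof. by move=> x y xy; apply/le_anti; rewrite -!lexemb_le xy lexx. Qed.

(** Elements with distinct first components are comparable, and elements with the
    same one differ by translation from elements of [G]. *)
Lemma lexembI : {morph lexemb : x y / x `&` y}.
Proof.
move=> x y; rewrite {1}[x `&` y]/Order.meet /=.
have cmp a b : a <= b -> lexemb a = lexemb a `&` lexemb b.
  by move=> ab; apply/esym/meet_idPl; rewrite lexemb_le.
case: (ltgtP x.1 y.1) => xy.
- by apply: cmp; rewrite lexprod_leE xy.
- by rewrite meetC; apply: cmp; rewrite lexprod_leE xy.
- by rewrite /lexemb /= jI lg_meetDl -xy.
Qed.

Variables (u : H) (u0 : 0 <= u) (v : K) (v0 : 0 <= v) (iu : i u = v).

Lemma lexemb_unit : lexemb (lexunit G u) = v.
Proof. by rewrite /lexemb /= j0 mulg1 iu. Qed.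

Fact lexemb_Gamma_subproof (z : Gamma (lexunit_ge0 G u0)) :
  0 <= lexemb (val z) <= v.
Proof. rewrite -lexemb_unit lexemb_le lexemb_ge0. exact: (valP z). Qed.

Definition lexemb_Gamma (z : Gamma (lexunit_ge0 G u0)) : Gamma v0 :=
  exist _ (lexemb (val z)) (lexemb_Gamma_subproof z).

Lemma lexemb_Gamma_hom : mv_homomorphism lexemb_Gamma.
Proof.
split=> [x y|x|x||]; apply: val_inj => /=.
- by rewrite lexembI lexembD lexemb_unit.
- by rewrite lexembD lexembN lexemb_unit.
- by rewrite lexembD lexembN lexemb_unit.
- exact: lexemb0.
- exact: lexemb_unit.
Qed.

Lemma lexemb_Gamma_inj : injective lexemb_Gamma.
Proof. by move=> x y /(congr1 val)/lexemb_inj/val_inj. Qed.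

End LexEmbedding.

(** * The linearly ordered group spanned by a chain subalgebra *)

Section ChainSpan.
Variables (K : lgroupType) (v : K) (v0 : 0 <= v) (v_gt0 : 0 < v).
Variable D : set (Gamma v0).
Hypothesis subD : mv_subalgebra D.
Hypothesis chainD :
  forall x y, D x -> D y -> (val x <= val y) || (val y <= val x).

Definition chain_span : {pred K} :=
  [pred k | `[< exists2 d, D d & exists z, k = val d + zmul v z >]].

Lemma chain_spanP k :
  reflect (exists2 d, D d & exists z, k = val d + zmul v z) (k \in chain_span).
Proof. exact: asboolP. Qed.

Let D_lneg : forall x, D x -> D x⁻. Proof. by case: subD. Qed.
Let D_rneg : forall x, D x -> D x∼. Proof. by case: subD. Qed.
Let D_add : forall x y, D x -> D y -> D (x ⊕ y). Proof. by case: subD. Qed.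
Let D0 : D mv0. Proof. by case: subD. Qed.
Let D1 : D mv1. Proof. by case: subD. Qed.

Lemma mem_chain_span d : D d -> val d \in chain_span.
Proof.
by move=> Dd; apply/chain_spanP; exists d => //; exists 0; rewrite mulg1.
Qed.

(** Conjugation by [v] is the double left negation in one direction and the double
    right negation in the other. *)
Lemma chain_conj d z : D d ->
  exists2 e, D e & zmul v z + val d = val e + zmul v z.
Proof.
suff main e : D e -> forall n,
    (exists2 e', D e' & v *+ n + val e = val e' + v *+ n) /\
    (exists2 e', D e' & - (v *+ n) + val e = val e' - v *+ n).
  by case: z => n /main h; [have [] := h n|have [] := h n.+1].
move=> De; elim=> [|n IH].
  by split; exists e; rewrite ?invg1 ?mulg1 ?mul1g.
split.
  have [[e' De' eE] _] := IH.
  exists e'⁻⁻; first by do 2!apply: D_lneg.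
  by rewrite expgS -mulgA eE !val_mvlneg invgM invgK !mulgA mulgVK.
have [_ [e' De' eE]] := IH.
exists e'∼∼; first by do 2!apply: D_rneg.
rewrite expgSr invgM -mulgA eE !val_mvrneg invgM invgK.
by rewrite !mulgA mulgK.
Qed.

(** Moving the multiples of [v] to the right leaves a difference [d - e'] of two
    elements of the chain.  If it is positive it is the truncated difference,
    hence in [D]; otherwise [d - e' + v] is the untruncated sum of [d] and the
    negation of [e'], hence in [D], and one [v] is subtracted. *)
Lemma chain_span_group : monoid.group_closed chain_span.
Proof.
split; first exact: (mem_chain_span D0).
move=> _ _ /chain_spanP[d Dd [a ->]] /chain_spanP[e De [b ->]].
have [e' De' eE] := chain_conj (a - b) De.
have eE' : zmul v (a - b) - val e = - val e' + zmul v (a - b).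
  by apply: (@mulgI _ (val e')); rewrite mulVKg mulgA -eE mulgK.
have -> : val d + zmul v a - (val e + zmul v b) =
    val d - val e' + zmul v (a - b).
  by rewrite -[RHS]mulgA -eE' zmulD zmulN invgM !mulgA.
case/orP: (chainD Dd De') => de; last first.
  apply/chain_spanP; exists (d ⊙ e'⁻).
    by apply: D_rneg; apply: D_add; do 2?apply: D_lneg.
  exists (a - b); rewrite val_mvdiff; congr (_ + _); apply/esym/join_idPl.
  by rewrite lg_subr_ge0.
apply/chain_spanP; exists (d ⊕ e'∼).
  by apply: D_add => //; exact: D_rneg.
exists (- Zone + (a - b)); rewrite (zmulD v (- Zone)) (zmulN v Zone) zmul1.
rewrite val_mvadd val_mvrneg.
have /meet_idPl -> : val d + (- val e' + v) <= v.
  by rewrite mulgA -[leRHS]mul1g lg_leD2r// lg_leBDr mul1g.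
by rewrite !mulgA mulgK.
Qed.

(** Since [0 <= d <= v], the multiple of [v] decides unless both are the same. *)
Lemma chain_span_total k l :
  k \in chain_span -> l \in chain_span -> (k <= l) || (l <= k).
Proof.
move=> /chain_spanP[d Dd [a ->]] /chain_spanP[e De [b ->]].
have far x y (p q : Zgroup) : p < q -> val (x : Gamma v0) + zmul v p <=
    val (y : Gamma v0) + zmul v q.
  rewrite -lg_subr_gt0 => /Zone_le; rewrite lg_leDBr => /(zmul_homo v0).
  rewrite zmulD zmul1 => pq.
  apply: (le_trans (lg_leD2r _ (Gamma_leu x))); apply: (le_trans pq).
  by rewrite -[leLHS]mul1g lg_leD2r ?Gamma_ge0.
case: (ltgtP a b) => [ab|ba|->]; last by rewrite !lg_leD2rE chainD.
  by rewrite far.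
by rewrite orbC far.
Qed.

Lemma chain_span_meet : meet_closed chain_span.
Proof.
move=> k l Sk Sl; case/orP: (chain_span_total Sk Sl) => [/meet_idPl|/meet_idPr].
  by move->.
by move->.
Qed.

(** A positive [d + z v] has [z >= 0]; it lies above [v] if [z > 0] and equals [d]
    if [z = 0]. *)
Lemma chain_span_pos k : k \in chain_span -> 0 < k ->
  exists d, [/\ D d, 0 < val d & val d <= k].
Proof.
move=> /chain_spanP[d Dd [z ->]] k0.
case: (ltgtP z 0) => [z0|z0|zE].
- have := lg_subr_gt0 z 0; rewrite z0 mul1g => /(zmul_gt0_le v0).
  rewrite zmulN => vz; move: k0; rewrite lt_leAnge => /andP[_ /negP[]].
  rewrite -[zmul v z]invgK lg_leBDr mul1g; exact: le_trans (Gamma_leu d) vz.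
- exists mv1; split=> //; apply: (le_trans (zmul_gt0_le v0 z0)).
  by rewrite -[leLHS]mul1g lg_leD2r ?Gamma_ge0.
- by exists d; split=> //; move: k0; rewrite zE zmul0 mulg1.
Qed.

(** For [z < 0] or [z > 0] an element [d + z v] of the interval [[0, v]] can only be
    the end point [0] or [v]. *)
Lemma chain_span_Gamma (x : Gamma v0) : val x \in chain_span -> D x.
Proof.
case/chain_spanP => d Dd [z xE].
case: (ltgtP z 0) => [z0|z0|zE].
- suff -> : x = mv0 by [].
  apply: val_inj; apply/le_anti; rewrite Gamma_ge0 andbT val_mv0 xE.
  have := lg_subr_gt0 z 0; rewrite z0 mul1g => /(zmul_gt0_le v0).
  rewrite zmulN => vz; rewrite -[zmul v z]invgK lg_leBDr mul1g.
  exact: le_trans (Gamma_leu d) vz.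
- suff -> : x = mv1 by [].
  apply: val_inj; apply/le_anti; rewrite Gamma_leu /= xE.
  apply: (le_trans (zmul_gt0_le v0 z0)).
  by rewrite -[leLHS]mul1g lg_leD2r ?Gamma_ge0.
- by suff -> : x = d by []; apply: val_inj; rewrite xE zE mulg1.
Qed.

End ChainSpan.

(** * The convex l-subgroup spanned by the ideal *)

Section IdealInGroup.
Variables (M : pseudoMVType) (I : set M).
Variables (K : lgroupType) (v : K) (v0 : 0 <= v).
Variables (phi : M -> Gamma v0) (psi : Gamma v0 -> M).
Hypotheses (phi_hom : mv_homomorphism phi).
Hypotheses (phiK : cancel phi psi) (psiK : cancel psi phi).
Variable delta : mvquot I -> M.
Hypotheses (delta_hom : mv_homomorphism delta).
Hypotheses (deltaK : cancel delta (@mvpi M I)).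
Hypotheses (idealI : mv_ideal I) (I_neqT : I <> setT) (strictI : mv_strict I).

Local Notation N x := (val (phi x)).

Lemma rep_inj x y : N x = N y -> x = y.
Proof. by move=> /val_inj/(can_inj phiK). Qed.

Lemma rep_ex k : 0 <= k <= v -> exists x, N x = k.
Proof. by move=> kP; exists (psi (exist _ k kP)); rewrite psiK. Qed.

Lemma repD x y : N (x ⊕ y) = (N x + N y) `&` v.
Proof. by case: phi_hom => ->. Qed.

Lemma rep_lneg x : N x⁻ = v - N x.
Proof. by case: phi_hom => _ ->. Qed.

Lemma rep0 : N mv0 = 0. Proof. by case: phi_hom => _ _ _ ->. Qed.

Lemma rep1 : N mv1 = v. Proof. by case: phi_hom => _ _ _ _ ->. Qed.

Lemma rep_diff x y : N (x ⊙ y⁻) = (N x - N y) `|` 0.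
Proof. by rewrite mv_hom_mul// -val_mvdiff; case: phi_hom => _ ->. Qed.

Lemma rep_meet x y : N (mvmeet x y) = N x `&` N y.
Proof. by rewrite mv_hom_meet// val_mvmeet. Qed.

Lemma mvle_rep x y : mvle x y <-> N x <= N y.
Proof.
rewrite -mvleE /mvle -mv_hom_meet//.
by split=> [->|/(can_inj phiK)].
Qed.

Lemma ideal_down x y : N x <= N y -> I y -> I x.
Proof. by case: idealI => _ dn _ /mvle_rep; exact: dn. Qed.

Lemma ideal0 : I mv0.
Proof.
by case: idealI => -[x Ix] _ _; apply: ideal_down Ix; rewrite rep0 Gamma_ge0.
Qed.

Lemma ideal_not1 : ~ I mv1.
Proof.
move=> I1; apply: I_neqT; apply/seteqP; split=> // x _.
by apply: ideal_down I1; rewrite rep1 Gamma_leu.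
Qed.

Lemma unit_gt0 : 0 < v.
Proof.
rewrite lt_neqAle v0 andbT; apply/eqP => v00; apply: ideal_not1.
by apply: ideal_down ideal0; rewrite rep1 rep0 -v00.
Qed.

Lemma mvclassP x y : mvclass I x y <->
  I (x ⊙ y⁻) /\ I (y ⊙ x⁻).
Proof.
split=> [Ixy|[]]; last by case: idealI => _ _ ; apply.
split; apply: ideal_down Ixy; rewrite repD lexI Gamma_leu andbT.
  by rewrite -[leLHS]mulg1 lg_leD2l ?Gamma_ge0.
by rewrite -[leLHS]mul1g lg_leD2r ?Gamma_ge0.
Qed.

(** For [a] in [I], the truncated difference of [a] and [y] is at most [a], hence in
    [I]; the one of [y] and [a] is at most [y], and together with [a] it bounds
    [y].  So [y] is in the class of [a] exactly if it is in [I]. *)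
Lemma mvpi_ideal a : I a -> mvpi I a = mv0.
Proof.
move=> Ia; apply: eq_exist.
apply/seteqP; split=> y /mvclassP[Iay Iya]; apply/mvclassP.
  split.
    apply: ideal_down ideal0; rewrite rep_diff rep0 mul1g leUx lexx andbT.
    by rewrite lg_oppr_le0 Gamma_ge0.
  case: idealI => _ _ addI; apply: ideal_down (addI _ _ Iya Ia).
  rewrite rep_diff rep0 invg1 mulg1 leUx !Gamma_ge0 andbT.
  by rewrite repD lexI Gamma_leu andbT rep_diff lg_joinDr mulgVK leUl.
split.
  apply: ideal_down Ia; rewrite rep_diff leUx Gamma_ge0 andbT.
  by rewrite lg_leBDr -[leLHS]mulg1 lg_leD2l ?Gamma_ge0.
apply: ideal_down Iya; rewrite !rep_diff rep0 invg1 mulg1 leUx leUr andbT.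
apply: le_trans (leUl _ _).
by rewrite lg_leBDr -[leLHS]mulg1 lg_leD2l ?Gamma_ge0.
Qed.

Lemma mvclass_refl x : mvclass I x x.
Proof.
by apply/mvclassP; split; apply: ideal_down ideal0;
  rewrite rep_diff mulgV joinxx rep0.
Qed.

Lemma mvpi_eq0 x : mvpi I x = mv0 -> I x.
Proof.
move=> /(congr1 (@proj1_sig _ _)) /= x0.
have /mvclassP[_] : mvclass I mv0 x.
  by rewrite -x0; exact: mvclass_refl.
by apply: ideal_down; rewrite rep_diff rep0 invg1 mulg1 leUl.
Qed.

(** An element of the ideal has the class of [0], and [delta] is a section. *)
Lemma ideal_retract q : I (delta q) -> delta q = mv0.
Proof.
by move=> /mvpi_ideal; rewrite deltaK => ->; case: delta_hom.
Qed.

(** The class of [a] is the bottom of [M/I] and that of [y] is not, so strictness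
    applies.  The order of [M/I] is examined through [delta]: it is an injective
    homomorphism, whereas the operations of [M/I] act on chosen
    representatives. *)
Lemma ideal_lt a y : I a -> ~ I y -> N a < N y.
Proof.
move=> Ia Iy; have /strictI[/mvle_rep ay ayn] : mvlt (mvpi I a) (mvpi I y).
  rewrite mvpi_ideal//; split; last by move=> /esym/mvpi_eq0.
  apply: (can_inj deltaK); rewrite mv_hom_meet//.
  case: delta_hom => _ _ _ -> _; apply: rep_inj.
  by rewrite rep_meet rep0; apply/meet_idPl; exact: Gamma_ge0.
by rewrite lt_neqAle ay andbT; apply/eqP => /rep_inj.
Qed.

(** The sum of two elements of the ideal is never truncated, as the complement of
    an element of a proper ideal lies outside the ideal. *)
Lemma ideal_rep_add a b : I a -> I b -> exists2 c, I c & N c = N a + N b.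
Proof.
move=> Ia Ib; exists (a ⊕ b); first by case: idealI => _ _; apply.
rewrite repD; apply/meet_idPl; rewrite -lg_leDBr -rep_lneg.
apply/ltW/ideal_lt => // Ib'; apply: ideal_not1; case: idealI => _ _ addI.
apply: ideal_down (addI _ _ Ib' Ib).
by rewrite rep1 repD rep_lneg mulgVK meetxx.
Qed.

Definition ideal_span : {pred K} :=
  [pred k | `[< exists a b, [/\ I a, I b & - N a <= k <= N b] >]].

Lemma ideal_spanP k :
  reflect (exists a b, [/\ I a, I b & - N a <= k <= N b]) (k \in ideal_span).
Proof. exact: asboolP. Qed.

Lemma ideal_span_group : monoid.group_closed ideal_span.
Proof.
split.
  apply/ideal_spanP; exists mv0, mv0; rewrite !rep0 invg1 lexx.
  by split=> //; exact: ideal0.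
move=> k l /ideal_spanP[a [b [Ia Ib /andP[ak kb]]]].
move=> /ideal_spanP[c [d [Ic Id /andP[cl ld]]]].
have [e Ie eE] := ideal_rep_add Id Ia; have [f If fE] := ideal_rep_add Ib Ic.
apply/ideal_spanP; exists e, f; split=> //; rewrite eE fE invgM.
by rewrite !lg_leD// ?lg_leN2// lg_leNl.
Qed.

Lemma ideal_span_meet : meet_closed ideal_span.
Proof.
move=> k l /ideal_spanP[a [b [Ia Ib /andP[ak kb]]]].
move=> /ideal_spanP[c [d [Ic Id /andP[cl ld]]]].
have [e Ie eE] := ideal_rep_add Ia Ic.
apply/ideal_spanP; exists e, b; split=> //; rewrite leIxl// andbT lexI.
apply/andP; split; [apply: le_trans ak|apply: le_trans cl]; rewrite lg_leN2 eE.
  by rewrite -[leLHS]mulg1 lg_leD2l ?Gamma_ge0.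
by rewrite -[leLHS]mul1g lg_leD2r ?Gamma_ge0.
Qed.

Lemma mem_ideal_span a : I a -> N a \in ideal_span.
Proof.
move=> Ia; apply/ideal_spanP; exists a, a; rewrite lexx; split=> //.
by rewrite andbT (le_trans _ (Gamma_ge0 (phi a)))// lg_oppr_le0 Gamma_ge0.
Qed.

Lemma ideal_span_ge0 k : k \in ideal_span -> 0 <= k -> exists2 a, I a & N a = k.
Proof.
move=> /ideal_spanP[_ [b [_ Ib /andP[_ kb]]]] k0.
have [|x xk] := @rep_ex k; first by rewrite k0 (le_trans kb) ?Gamma_leu.
by exists x => //; apply: ideal_down Ib; rewrite xk.
Qed.

(** The positive and negative parts of [k] belong to the ideal. *)
Lemma ideal_span_commute h k :
  (forall a, I a -> h + N a = N a + h) -> k \in ideal_span -> h + k = k + h.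
Proof.
move=> hC Sk; rewrite [k]lg_pos_neg.
have pos l : l \in ideal_span -> commute h (l `|` 0).
  move=> Sl; have Sl0 : l `|` 0 \in ideal_span.
    apply: (lg_join_closed ideal_span_group ideal_span_meet) => //.
    by case: ideal_span_group.
  by have [a Ia <-] := ideal_span_ge0 Sl0 (leUr _ _); exact: hC.
apply: commuteM; first exact: pos.
by apply/commuteV/pos/group_closedV => //; exact: ideal_span_group.
Qed.

Definition ideal_lgroup : lgroupType := lsub ideal_span_group ideal_span_meet.

(** If every positive element of [i H] dominates an element outside [I], it also
    dominates all of the span of [I], by strictness; so [H] and this span generate
    their lexicographic product inside [K].  As the embedding reflects the order,
    an element of [M] that decomposes in [K] is already in the image. *)
Lemma lex_embedding (H : logroupType) (i : H -> K) (u : H) (u0 : 0 <= u) :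
  {morph i : x y / x + y} -> i u = v ->
  (forall h, 0 < h -> exists2 y, ~ I y & N y <= i h) ->
  (forall h a, I a -> i h + N a = N a + i h) ->
  exists F : Gamma (lexunit_ge0 ideal_lgroup u0) -> M,
    [/\ mv_homomorphism F, injective F,
        forall z, N (F z) = i (val z).1 + val (val z).2,
        forall z, I (F z) <-> (val z).1 = 0
      & forall x h (g : ideal_lgroup), N x = i h + val g -> exists z, F z = x].
Proof.
move=> iD iu i_gt0 iC.
pose j (g : ideal_lgroup) : K := val g.
have jD : {morph j : x y / x + y} by [].
have jI : {morph j : x y / x `&` y} by [].
have ijC h g : i h + j g = j g + i h.
  by apply: ideal_span_commute (valP g) => a; exact: iC.
have ij_gt0 h g : 0 < h -> 0 < i h + j g.
  move=> /i_gt0[y Iy yh]; have /ideal_spanP[a [_ [Ia _ /andP[ag _]]]] := valP g.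
  apply: lt_le_trans (lg_leD yh ag); rewrite lg_subr_gt0; exact: ideal_lt.
pose F := @lexemb_Gamma _ _ _ _ _ iD jD jI val_inj ijC ij_gt0 _ u0 _ v0 iu.
have Fhom : mv_homomorphism F by exact: lexemb_Gamma_hom.
have Finj : injective F by exact: lexemb_Gamma_inj.
have NF z : N ((psi \o F) z) = i (val z).1 + val (val z).2 by rewrite /= psiK.
exists (psi \o F); split=> //.
- by apply: mv_hom_comp Fhom _; exact: mv_hom_can phi_hom phiK psiK.
- by apply: inj_comp Finj; exact: can_inj psiK.
- move=> z; split=> [IF|z1].
    have zge0 : 0 <= val z := Gamma_ge0 z; move: zge0; rewrite lexprod_leE /=.
    case/orP => [z1|/andP[/eqP <-//]].
    (* a positive first component h would make h + g', with g' = (val z).2, equal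
       to an element g of the span, contradicting 0 < h + (g' - g) *)
    have gS : N (psi (F z)) \in ideal_span by exact: mem_ideal_span.
    pose g : ideal_lgroup := exist (fun k => k \in ideal_span) _ gS.
    have := ij_gt0 (val z).1 ((val z).2 - g) z1.
    have -> : j ((val z).2 - g) = val (val z).2 - N (psi (F z)) by [].
    by rewrite mulgA -NF mulgV ltxx.
  have i0 : i 0 = 0 by apply: (@mulgI _ (i 0)); rewrite -iD !mulg1.
  have zge0 : 0 <= (val z).2.
    by have := Gamma_ge0 z; rewrite lexprod_leE z1 ltxx eqxx.
  have [a Ia aE] := ideal_span_ge0 (valP (val z).2) zge0.
  suff -> : (psi \o F) z = a by [].
  by apply: rep_inj; rewrite NF z1 i0 mul1g aE.
- move=> x h g xE.
  have zP : 0 <= ((h, g) : lexprod H ideal_lgroup) <= lexunit ideal_lgroup u.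
    rewrite -(lexemb_ge0 iD jD jI val_inj ijC ij_gt0).
    rewrite -(lexemb_le iD jD jI val_inj ijC ij_gt0).
    rewrite (lexemb_unit jD iu) /lexemb /= -xE.
    exact: (valP (phi x)).
  exists (exist (fun z => 0 <= z <= lexunit ideal_lgroup u) _ zP).
  by apply: rep_inj; rewrite NF xE.
Qed.

(** * The subalgebra generated by the ideal *)

Lemma mvgen_inj (x y : mvgen I) : proj1_sig x = proj1_sig y -> x = y.
Proof. by case: x y => [x Sx] [y Sy] /= xy; exact: eq_exist. Qed.

(** An element of [Gamma(Z x G, (1, 0))] has first component [0] or [1]: it
    represents an element of [I] or the negation of one.  Hence the image of the
    embedding lies in [<I>], and it is a subalgebra containing [I]. *)
Lemma mvgen_isomorphic : (forall a, I a -> v + N a = N a + v) ->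
  mv_isomorphic (mvgen I) (Gamma (lexunit_ge0 ideal_lgroup Zone_ge0)).
Proof.
move=> vC.
have v_large (z : Zgroup) : 0 < z -> exists2 y, ~ I y & N y <= zmul v z.
  move=> /(zmul_gt0_le v0) vz; exists mv1; first exact: ideal_not1.
  by rewrite rep1.
have zC (z : Zgroup) a : I a -> zmul v z + N a = N a + zmul v z.
  by move=> Ia; apply: zmul_commute; exact: vC.
have [F [Fhom Finj FN FI Fex]] :=
  lex_embedding Zone_ge0 (zmulD v) (zmul1 v) v_large zC.
have [FD Fl Fr F0 F1] := Fhom.
have SF z : smallest (@mv_subalgebra M) I (F z).
  move=> S [[SD Sl Sr S0 S1] IS]; have [z1|z1] := pselect ((val z).1 = 0).
    exact/IS/FI.
  have {}z1 : (val z).1 = Zone.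
    have /andP[z_ge0 z_le1] := lexGamma_fst z.
    apply/le_anti; rewrite z_le1 Zone_le// lt_neqAle z_ge0 andbT.
    by apply/eqP => /esym.
  suff : I (F z∼) by move=> /IS/Sl; rewrite -Fl Gamma_rnegK.
  by apply/FI; rewrite /= z1 mulVg.
have Fsurj x : smallest (@mv_subalgebra M) I x -> exists z, F z = x.
  move=> /(_ [set y | exists z, F z = y]); apply; split; last first.
    move=> a Ia; have aS := mem_ideal_span Ia.
    apply: (Fex _ 0 (exist (fun k => k \in ideal_span) _ aS)).
    by rewrite zmul0 mul1g.
  split=> [_ _ [x1 <-] [y1 <-]|_ [x1 <-]|_ [x1 <-]||].
  - by exists (x1 ⊕ y1).
  - by exists x1⁻.
  - by exists x1∼.
  - by exists mv0.
  - by exists mv1.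
pose F' z : mvgen I := exist _ (F z) (SF z).
have F'hom : mv_homomorphism F'.
  by split=> [y z|z|z||]; apply: mvgen_inj => /=.
have [|x|g F'K gK] := @inj_surj_can _ _ F'.
- by move=> y z /(congr1 (@proj1_sig _ _))/Finj.
- by have [z zx] := Fsurj _ (svalP x); exists z; apply: mvgen_inj.
exact: mv_isomorphic_can (mv_hom_can F'hom F'K gK) gK F'K.
Qed.

(** * The linearly ordered group of the quotient *)

Hypothesis primeI : mv_prime I.

Definition retract : set (Gamma v0) := range (phi \o delta).

Lemma retract_subalgebra : mv_subalgebra retract.
Proof.
have [hD hl hr h0 h1] := mv_hom_comp delta_hom phi_hom.
split=> [_ _ [p _ <-] [q _ <-]|_ [p _ <-]|_ [p _ <-]||].
- by exists (p ⊕ q).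
- by exists p⁻.
- by exists p∼.
- by exists mv0.
- by exists mv1.
Qed.

(** The truncated differences of [x] and [y] are disjoint, so one of them is in the
    prime ideal [I]; being in the image of [delta] as well, it vanishes. *)
Lemma retract_chain x y :
  retract x -> retract y -> (val x <= val y) || (val y <= val x).
Proof.
have le p q : I (delta p ⊙ (delta q)⁻) -> N (delta p) <= N (delta q).
  case: (delta_hom) => _ dl _ _ _; rewrite -dl -mv_hom_mul// => /ideal_retract.
  rewrite mv_hom_mul// dl => /(congr1 phi)/(congr1 val).
  by rewrite rep_diff rep0 => /join_idPr; rewrite lg_leBDr mul1g.
move=> [p _ <-] [q _ <-] /=.
have : I (mvmeet (delta p ⊙ (delta q)⁻) (delta q ⊙ (delta p)⁻)).
  apply: ideal_down ideal0; rewrite rep_meet !rep_diff rep0.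
  by rewrite -(invgF (N (delta p))) lg_pos_neg_disjoint.
by case/primeI => /le ->; rewrite ?orbT.
Qed.

Let spanS := chain_span_group retract_subalgebra retract_chain.
Let spanI := chain_span_meet retract_chain.

Definition retract_lgroup : lgroupType := lsub spanS spanI.

Fact retract_lgroup_total : total (<=%O : rel retract_lgroup).
Proof.
by move=> x y; exact: (chain_span_total retract_chain (valP x) (valP y)).
Qed.

Definition retract_group : logroupType :=
  HB.pack_for logroupType (LGroup.sort retract_lgroup)
    (LGroup.class retract_lgroup)
    (Order.Lattice_isTotal.Build _ retract_lgroup retract_lgroup_total).

Definition retract_val (h : retract_group) : K := val (h : retract_lgroup).

Lemma retract_in q : N (delta q) \in chain_span retract.
Proof. by apply: mem_chain_span; exists q. Qed.

Definition retract_elt q : retract_group :=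
  exist (fun k => k \in chain_span retract) _ (retract_in q).

Definition retract_unit : retract_group := retract_elt mv1.

Lemma retract_val_unit : retract_val retract_unit = v.
Proof.
by rewrite /retract_val /=; case: delta_hom => _ _ _ _ ->; rewrite rep1.
Qed.

Lemma retract_val_le h k : (retract_val h <= retract_val k) = (h <= k).
Proof. by []. Qed.

Lemma retract_valD : {morph retract_val : h k / h + k}.
Proof. by []. Qed.

Lemma retract_valI : {morph retract_val : h k / h `&` k}.
Proof. by []. Qed.

Lemma retract_unit_ge0 : 0 <= retract_unit.
Proof. by rewrite -retract_val_le retract_val_unit. Qed.

Lemma retract_val_inj : injective retract_val.
Proof. exact: val_inj. Qed.

Lemma retract_strong_unit : strong_unit v -> strong_unit retract_unit.
Proof.
move=> [_ v_unit]; split=> [|h]; first exact: retract_unit_ge0.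
have [n nP] := v_unit (retract_val h); exists n.
have E : retract_val (retract_unit *+ n) = v *+ n.
  elim: n {nP} => // n IH; rewrite !expgS retract_valD IH; congr (_ + _).
  exact: retract_val_unit.
by rewrite -!retract_val_le E -E in nP *.
Qed.

(** A positive element of the span dominates a nonzero value of [delta], and such
    a value is not in [I]. *)
Lemma retract_val_large h :
  0 < h -> exists2 y, ~ I y & N y <= retract_val h.
Proof.
move=> h_gt0.
have [d [[q _ <-] d0 dh]] :=
  chain_span_pos unit_gt0 retract_subalgebra (valP h) h_gt0.
exists (delta q) => // /ideal_retract dq; move: d0.
by rewrite /= dq rep0 ltxx.
Qed.

Fact retract_Gamma_subproof q : 0 <= retract_elt q <= retract_unit.
Proof.
by rewrite -!retract_val_le retract_val_unit; exact: (valP (phi (delta q))).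
Qed.

Definition retract_Gamma q : Gamma retract_unit_ge0 :=
  exist _ (retract_elt q) (retract_Gamma_subproof q).

Lemma retract_Gamma_iso :
  exists rho : Gamma retract_unit_ge0 -> mvquot I, mv_isomorphism rho.
Proof.
have [hD hl hr h0 h1] := mv_hom_comp delta_hom phi_hom.
have rhom : mv_homomorphism retract_Gamma.
  split=> [p q|p|p||]; apply/val_inj/retract_val_inj.
  - rewrite val_mvadd retract_valI retract_valD retract_val_unit.
    by have /= := congr1 val (hD p q).
  - rewrite val_mvlneg retract_valD retract_val_unit.
    by have /= := congr1 val (hl p).
  - rewrite val_mvrneg retract_valD retract_val_unit.
    by have /= := congr1 val (hr p).
  - by have /= := congr1 val h0.
  - by [].
have [||rho rK rhoK] := @inj_surj_can _ _ retract_Gamma.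
- move=> p q /(congr1 (fun t => retract_val (val t)))/rep_inj.
  exact: (can_inj deltaK).
- move=> t; have tP : 0 <= retract_val (val t) <= v.
    by have := valP t; rewrite -!retract_val_le retract_val_unit.
  have [x xt] := rep_ex tP.
  have /(chain_span_Gamma retract_subalgebra)[q _ qx] :
    N x \in chain_span retract by rewrite xt; exact: (valP (val t)).
  by exists q; apply/val_inj/retract_val_inj; rewrite -xt -qx.
exists rho; split; last by exists retract_Gamma.
exact: mv_hom_can rhom rK rhoK.
Qed.

(** * The lexicographic decomposition *)

Lemma retract_unit_gt0 : 0 < retract_unit.
Proof.
rewrite lt_neqAle retract_unit_ge0 andbT; apply/eqP => /(congr1 retract_val).
by rewrite retract_val_unit => v00; have := unit_gt0; rewrite -v00 ltxx.
Qed.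

Hypothesis retractC :
  forall q a, I a -> N (delta q) + N a = N a + N (delta q).

Lemma unit_commute a : I a -> v + N a = N a + v.
Proof.
move=> Ia; have := retractC mv1 Ia.
by case: delta_hom => _ _ _ _ ->; rewrite rep1.
Qed.

Lemma retract_val_commute h a :
  I a -> retract_val h + N a = N a + retract_val h.
Proof.
move=> Ia; have /chain_spanP[_ [q _ <-] [z hE]] := valP h.
rewrite [retract_val h]hE; apply/commute_sym/commuteM; apply/commute_sym.
  exact: retractC.
by apply: zmul_commute; exact: unit_commute.
Qed.

(** It is onto: [x] and [y = delta (x / I)] are in the same class, so that [x - y] is
    squeezed between their truncated differences, which are in [I]; and
    [x = (x - y) + y = y + (x - y)]. *)
Lemma retract_embedding :
  exists F : Gamma (lexunit_ge0 ideal_lgroup retract_unit_ge0) -> M,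
    mv_isomorphism F /\ forall z, I (F z) <-> (val z).1 = 0.
Proof.
have [F [Fhom Finj FN FI Fex]] := lex_embedding retract_unit_ge0 retract_valD
  retract_val_unit retract_val_large retract_val_commute.
exists F; split=> //; split=> //.
suff Fsurj x : exists z, F z = x.
  by have [g FK gK] := inj_surj_can Finj Fsurj; exists g.
pose y := delta (mvpi I x).
have /mvclassP[Iyx Ixy] : mvclass I y x.
  have -> : mvclass I y = mvclass I x.
    by have /(congr1 (@proj1_sig _ _)) := deltaK (mvpi I x).
  exact: mvclass_refl.
have gS : N x - N y \in ideal_span.
  apply/ideal_spanP; exists (y ⊙ x⁻), (x ⊙ y⁻); split=> //.
  by rewrite !rep_diff leUl andbT lg_leNl invgF leUl.
apply: (Fex _ (retract_elt (mvpi I x))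
              (exist (fun k => k \in ideal_span) _ gS)).
rewrite /= (ideal_span_commute _ gS) ?mulgVK//.
by move=> a; exact: retractC.
Qed.

End IdealInGroup.

Theorem theorem3p6 (M : pseudoMVType) (I : set M) :
  lexicographic_ideal I ->
  exists (H : logroupType) (u : H) (u0 : 0 <= u) (G : lgroupType),
    [/\ strong_unit u,
        mv_isomorphic (mvquot I) (Gamma u0),
        mv_isomorphic (mvgen I) (Gamma (lexunit_ge0 G Zone_ge0)),
        mv_isomorphic M (Gamma (lexunit_ge0 G u0))
      & forall (G' : lgroupType) (f : M -> Gamma (lexunit_ge0 G' u0)),
          mv_isomorphism f -> f @` I = lexinfinitesimal G' u0 ->
          lgroup_isomorphic G' G].
Proof.
move=> [[idealI _] [_ I_neqT] strictI primeI].
move=> [K [v [v0 [phi [delta [v_unit [phi_hom [psi phiK psiK]]]]]]]].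
move=> [delta_hom deltaK] lex.
pose u := retract_unit phi_hom phiK delta_hom deltaK idealI primeI.
pose u0 : 0 <= u := retract_unit_ge0 _ _ _ _ _ _.
have u_unit : strong_unit u by exact: retract_strong_unit.
have [rho rho_iso] :=
  retract_Gamma_iso phi_hom phiK psiK delta_hom deltaK idealI primeI.
have [rho_add _] := lex _ u u0 rho u_unit rho_iso.
(* additivity of delta for the pair of delta q and a, the latter over the class 0:
   there q + 0 = q in the group of the quotient, and the equation reads
   delta q + a - delta q = a *)
have retractC q a :
    I a ->
    val (phi (delta q)) + val (phi a) = val (phi a) + val (phi (delta q)).
  have [[_ _ _ rho0 _] [r rK Kr]] := rho_iso.
  have [_ _ _ delta0 _] := delta_hom.
  move=> Ia; have := rho_add (r q) mv0 (r q) _ (delta q) a.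
  rewrite deltaK Kr rho0 delta0 (mvpi_ideal phi_hom phiK idealI Ia).
  rewrite val_mv0 mulg1 mulgV mul1g (rep0 phi_hom) invg1 mulg1.
  by move=> /(_ erefl erefl erefl) {2}<-; rewrite mulgVK.
have [F [F_iso FI]] := retract_embedding phi_hom phiK psiK delta_hom deltaK
  idealI I_neqT strictI primeI retractC.
have [F_hom [F' FK KF]] := F_iso.
exists _, u, u0.
exists (ideal_lgroup phi_hom phiK delta_hom deltaK idealI I_neqT strictI).
split=> //.
- have [rho_hom [r rK Kr]] := rho_iso.
  exact: mv_isomorphic_can (mv_hom_can rho_hom rK Kr) Kr rK.
- apply: mvgen_isomorphic => //.
  exact: unit_commute retractC.
- exact: mv_isomorphic_can (mv_hom_can F_hom FK KF) KF FK.
move=> G' f [f_hom [f' fK Kf]] fI.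
have u_gt0 : 0 < u by exact: retract_unit_gt0.
have F'h := mv_hom_can F_hom FK KF; have f'h := mv_hom_can f_hom fK Kf.
apply: (lgroup_isomorphic_infinitesimal (f := F' \o f') u_gt0).
  by split; [exact: mv_hom_comp|exists (f \o F); exact: can_comp].
move=> z; rewrite -FI /= KF.
have -> : ((val z).1 = 0) = lexinfinitesimal G' u0 z by [].
rewrite -fI; split=> [Ifz|[x Ix <-]]; last by rewrite fK.
by exists (f' z).
Qed.
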